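(* Let $n\geq 2$ and let $G\leq S_n$. Then $V_n(G)\cong V_n$ (as abstract groups) if and only if $G$ is semiregular.
   Context: $S_n$ is the symmetric group on $\{1,2,\dots,n\}$, acting on the right ($i\cdot g$ is the image of $i$ under $g$); all maps are composed from left to right. A subgroup $G\leq S_n$ is semiregular if no non-trivial element of $G$ fixes a point of $\{1,\dots,n\}$. Let $\mathfrak{C}_n=\{1,2,\dots,n\}^{\omega}$ be the space of infinite words over $\{1,\dots,n\}$ with the product topology. For a finite word $\theta\in\{1,\dots,n\}^*$ (possibly empty), the cone of $\theta$ is $[\theta]=\{\theta u: u\in\{1,\dots,n\}^\omega\}\subset\mathfrak{C}_n$. The Higman-Thompson group $V_n$ is the group of all homeomorphisms $v$ of $\mathfrak{C}_n$ for which there are two partitions of $\mathfrak{C}_n$ into the same finite number $t$ of cones, $[\alpha_1],\dots,[\alpha_t]$ and $[\beta_1],\dots,[\beta_t]$, such that $(\alpha_i\gamma)\cdot v=\beta_i\gamma$ for all $i$ and all $\gamma\in\{1,\dots,n\}^\omega$. For $g\in S_n$ and a finite word $\alpha$, the iterated permutation $[\alpha]_g$ is the homeomorphism of $\mathfrak{C}_n$ that is the identity outside $[\alpha]$ and satisfies $(\alpha b_1b_2b_3\dots)\cdot[\alpha]_g=\alpha(b_1\cdot g)(b_2\cdot g)(b_3\cdot g)\dots$ for all $b_1b_2b_3\dots\in\mathfrak{C}_n$. For $G\leq S_n$, $V_n(G)$ is the group of homeomorphisms of $\mathfrak{C}_n$ generated by $V_n$ together with all $[\alpha]_g$ with $g\in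 G$ and $\alpha\in\{1,\dots,n\}^*$. *)

(* Defs.v *)
From HB Require Import structures.
From mathcomp Require Import all_boot all_order all_algebra all_fingroup.
From mathcomp Require Import all_classical all_reals all_analysis.

Set Implicit Arguments.
Unset Strict Implicit.
Unset Printing Implicit Defensive.

Local Open Scope classical_set_scope.
Local Open Scope group_scope.

Record homeo (T : topologicalType) := Homeo {
  homeo_fun :> T -> T;
  homeo_inv : T -> T;
  homeo_funK : cancel homeo_fun homeo_inv;
  homeo_invK : cancel homeo_inv homeo_fun;
  homeo_fun_continuous : continuous homeo_fun;
  homeo_inv_continuous : continuous homeo_inv }.

Section HomeoGroup.
Context {T : topologicalType}.
Implicit Types f g h : homeo T.

Lemma homeoP f g : f =1 g -> f = g.
Proof.
case: f => f f' fK f'K fc f'c; case: g => g g' gK g'K gc g'c /= /funext fg.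
subst g; have /funext e : f' =1 g' by move=> x; rewrite -[in LHS](g'K x) fK.
subst g'; congr Homeo; exact: Prop_irrelevance.
Qed.

Definition homeo_one : homeo T :=
  @Homeo T id id (fun=> erefl) (fun=> erefl) (fun=> cvg_id) (fun=> cvg_id).

Definition homeo_opp f : homeo T :=
  Homeo (@homeo_invK _ f) (@homeo_funK _ f)
    (@homeo_inv_continuous _ f) (@homeo_fun_continuous _ f).

Lemma homeo_comp_continuous (f g : T -> T) :
  continuous f -> continuous g -> continuous (g \o f).
Proof. by move=> fc gc x; apply: continuous_comp; [exact: fc|exact: gc]. Qed.

(* Maps act on the right: f * g is f followed by g. *)
Definition homeo_mul f g : homeo T :=
  @Homeo T (g \o f) (homeo_inv f \o homeo_inv g)
    (can_comp (@homeo_funK _ g) (@homeo_funK _ f))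
    (can_comp (@homeo_invK _ f) (@homeo_invK _ g))
    (homeo_comp_continuous (@homeo_fun_continuous _ f)
                           (@homeo_fun_continuous _ g))
    (homeo_comp_continuous (@homeo_inv_continuous _ g)
                           (@homeo_inv_continuous _ f)).

Lemma homeo_mulA : associative homeo_mul.
Proof. by move=> f g h; apply: homeoP. Qed.
Lemma homeo_mul1 : left_id homeo_one homeo_mul.
Proof. by move=> f; apply: homeoP. Qed.
Lemma homeo_mulr1 : right_id homeo_one homeo_mul.
Proof. by move=> f; apply: homeoP. Qed.
Lemma homeo_mulV : left_inverse homeo_one homeo_opp homeo_mul.
Proof. by move=> f; apply: homeoP => x /=; rewrite homeo_invK. Qed.
Lemma homeo_mulrV : right_inverse homeo_one homeo_opp homeo_mul.
Proof. by move=> f; apply: homeoP => x /=; rewrite homeo_funK. Qed.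

End HomeoGroup.

HB.instance Definition _ (T : topologicalType) := gen_eqMixin (homeo T).
HB.instance Definition _ (T : topologicalType) := gen_choiceMixin (homeo T).
HB.instance Definition _ (T : topologicalType) :=
  isGroup.Build (homeo T) homeo_mulA homeo_mul1 homeo_mulr1
    homeo_mulV homeo_mulrV.

Definition generated (X : groupType) (A : set X) : set X :=
  smallest (fun H : set X => group_closed [in H]) A.

(* Isomorphism of subgroups A of X and B of Y as abstract groups; the values of
   phi outside A are irrelevant. *)
Definition isomorphic (X Y : groupType) (A : set X) (B : set Y) : Prop :=
  exists phi : X -> Y,
    {in A &, {morph phi : x y / x * y}} /\ set_bij A B phi.

Definition semiregular_perm n (G : {group 'S_n}) : Prop :=
  forall g, g \in G -> g != 1 -> forall i : 'I_n, g i != i.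

Lemma prod_continuous (X : topologicalType) (I : eqType)
    (K : I -> topologicalType) (f : X -> prod_topology K) :
  (forall k, continuous (fun x => f x k)) -> continuous f.
Proof.
move=> fc x; apply/cvg_sup => k U [V] [[W] oW <-] WfN WU.
by apply: (filterS WU); exact: (fc k x W (open_nbhs_nbhs (conj oW WfN))).
Qed.

(* Letters are 0, ..., n-1. *)
Definition Cantor (n : nat) : topologicalType :=
  prod_topology (fun _ : nat => discrete_topology 'I_n).

Section Words.
Context {n : nat}.
Implicit Types (a b th : seq 'I_n) (u x y : Cantor n) (g : 'S_n).

(* The infinite word th u; the default value of nth is used exactly at the
   positions k >= size th. *)
Definition wcat th u : Cantor n :=
  fun k => nth (u (k - size th)%N : 'I_n) th k.

Definition cone th : set (Cantor n) := range (wcat th).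

Lemma coneP th x :
  cone th x <-> mkseq (x : nat -> 'I_n) (size th) = th.
Proof.
split=> [[u _ <-]|e].
  apply: (@eq_from_nth _ (u 0%N)); rewrite size_mkseq// => k kth.
  by rewrite nth_mkseq// /wcat; apply: set_nth_default.
exists (fun k => x (size th + k)%N) => //; apply/funext => k; rewrite /wcat.
have [kth|kth] := ltnP k (size th).
  by rewrite -[in LHS]e nth_mkseq.
by rewrite nth_default// subnKC.
Qed.

Definition iterperm_fun a g x : Cantor n :=
  fun k => if (mkseq (x : nat -> 'I_n) (size a) == a) && (size a <= k)%N
           then g (x k) else x k.

Lemma Cantor_continuous (f : Cantor n -> Cantor n) :
  (forall k, exists m, forall x y, (forall i, (i < m)%N -> x i = y i) ->
     f x k = f y k) -> continuous f.
Proof.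
move=> fP; apply: prod_continuous => k x; have [m fm] := fP k.
have nx l : nbhs x [set y : Cantor n | forall i, (i < l)%N -> x i = y i].
  elim: l => [|l IH]; first by apply: filterS filterT.
  have nm : nbhs x [set y : Cantor n | y l = x l].
    exact: (@proj_continuous nat (fun=> discrete_topology 'I_n) l x _
             (@discrete_set1 (discrete_topology 'I_n) (x l))).
  apply: filterS2 IH nm => y /= IHy xy i.
  by rewrite ltnS leq_eqVlt => /orP[/eqP ->|/IHy].
move=> W /= Wfx; apply: filterS (nx m) => y /fm e /=.
by rewrite -e; exact: nbhs_singleton Wfx.
Qed.

Lemma iterperm_fun_continuous a g : continuous (iterperm_fun a g).
Proof.
apply: Cantor_continuous => k; exists (maxn k.+1 (size a)) => x y xy.
have e : mkseq (x : nat -> 'I_n) (size a) = mkseq (y : nat -> 'I_n) (size a).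
  apply/eq_in_map => i; rewrite mem_iota add0n => /andP[_ ia].
  by apply: xy; rewrite leq_max ia orbT.
by rewrite /iterperm_fun e xy// leq_max ltnSn.
Qed.

Lemma iterperm_funK a g : cancel (iterperm_fun a g) (iterperm_fun a g^-1).
Proof.
move=> x; apply/funext => k; rewrite {1}/iterperm_fun.
have -> : mkseq (iterperm_fun a g x : nat -> 'I_n) (size a) =
          mkseq (x : nat -> 'I_n) (size a).
  apply/eq_in_map => i; rewrite mem_iota add0n => /andP[_ ia].
  by rewrite /iterperm_fun leqNgt ia andbF.
by rewrite /iterperm_fun; case: (_ && _); rewrite ?permK.
Qed.

Lemma iterperm_funVK a g : cancel (iterperm_fun a g^-1) (iterperm_fun a g).
Proof. by rewrite -{2}[g]invgK; exact: iterperm_funK. Qed.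

(* The iterated permutation [a]_g; it is determined by the two lemmas below. *)
Definition iterperm a g : homeo (Cantor n) :=
  Homeo (iterperm_funK a g) (iterperm_funVK a g)
    (@iterperm_fun_continuous a g) (@iterperm_fun_continuous a g^-1).

Lemma iterperm_out a g x : ~ cone a x -> iterperm a g x = x.
Proof.
move=> /coneP/eqP/negbTE ax; apply/funext => k.
by rewrite /= /iterperm_fun ax.
Qed.

Lemma iterperm_wcat a g u :
  iterperm a g (wcat a u) = wcat a (fun k => g (u k)).
Proof.
have /coneP ea : cone a (wcat a u) by exists u.
apply/funext => k; rewrite /= /iterperm_fun ea eqxx /= /wcat.
case: leqP => ka; first by rewrite !nth_default.
exact: set_nth_default.
Qed.

End Words.

Definition cone_partition n t (a : 'I_t -> seq 'I_n) : Prop :=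
  classical_sets.partition setT (fun i => cone (a i)) [set: Cantor n].

Definition HigmanThompson n : set (homeo (Cantor n)) :=
  [set v | exists t (a b : 'I_t -> seq 'I_n),
    [/\ cone_partition a, cone_partition b &
        forall i u, v (wcat (a i) u) = wcat (b i) u]].

Arguments HigmanThompson : clear implicits.

Definition HigmanThompson_ext n (G : {group 'S_n}) : set (homeo (Cantor n)) :=
  generated (HigmanThompson n `|`
             [set v | exists a, exists2 g, g \in G & v = iterperm a g]).

(* Main.v *)
Require Import Defs.
From mathcomp Require Import all_boot all_fingroup.
From mathcomp Require Import boolp classical_sets functions topology zify.

(* By compactness, [V_n(G)] is the group of the homeomorphisms that act on some
   cone around each point as [a u |-> b (u . g)] with [g] in [G]; [V_n] is the
   case [G = 1].

   If [G] is semiregular, choose [lam i] in [G] with [lam (i . g) = lam i * g]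
   for all [g] in [G].  Recoding the letter [x_(k+1)] as
   [x_(k+1) . (lam x_k)^-1] conjugates [V_n(G)] onto [V_n], because simultaneous
   application of [g] to all letters changes only the first recoded letter.

   Conversely, disjointness of supports can be expressed algebraically up to
   twelfth powers, as in the short proof of Rubin's theorem by Belk, Elliott and
   Matucci.  In [V_n] a torsion element fixing a point is the identity on a cone
   around it; hence a torsion element [f] with dense support is free, and the
   space is covered by finitely many cones disjoint from their images under [f].
   In algebraic form this property of [V_n] passes to isomorphic groups.  If
   some [g <> 1] in [G] fixes a letter [i], it fails in [V_n(G)] for the
   iterated permutation of the empty word by [g]: its support is dense, but it
   fixes the point [i i i ...], and an element of [V_n(G)] acting non-trivially
   on every neighbourhood of [i i i ...] moves a dense set of points of some
   neighbourhood, so that its support meets the image of that support. *)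

Set Implicit Arguments.
Unset Strict Implicit.
Unset Printing Implicit Defensive.

Local Open Scope group_scope.

(** * Local description of the groups *)

Section LocalAction.
Context {n : nat}.
Implicit Types (x y z p : Cantor n) (f h v : homeo (Cantor n)) (g : 'S_n)
  (G : {group 'S_n}).

Definition agree m x y := forall i, (i < m)%N -> x i = y i.

Definition splice m x z : Cantor n :=
  fun k => if (k < m)%N then x k else z (k - m)%N.

Definition shift m z : Cantor n := fun k => z (m + k)%N.

Definition const (i : 'I_n) : Cantor n := fun=> i.

(* On the cone of the first [m] letters [a] of [x], [h] is [a u |-> b (u . g)],
   where [b] consists of the first [q] letters of [h x]. *)
Definition acts_at h x m q g :=
  forall z, agree m x z ->
    agree q (h x) (h z) /\ forall k, h z (q + k)%N = g (z (m + k)%N).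

Definition piecewise G : set (homeo (Cantor n)) :=
  [set h | forall x, exists m q, exists2 g, g \in G & acts_at h x m q g].

Lemma agree_refl m x : agree m x x. Proof. by []. Qed.

Lemma agree_sym m x y : agree m x y -> agree m y x.
Proof. by move=> xy i im; rewrite xy. Qed.

Lemma agree_trans m y x z : agree m x y -> agree m y z -> agree m x z.
Proof. by move=> xy yz i im; rewrite xy// yz. Qed.

Lemma agree_le m k x y : (k <= m)%N -> agree m x y -> agree k x y.
Proof. by move=> km xy i ik; apply: xy; lia. Qed.

Lemma agree_splice m x z : agree m x (splice m x z).
Proof. by move=> i im; rewrite /splice im. Qed.

Lemma splice_lt m x z k : (k < m)%N -> splice m x z k = x k.
Proof. by rewrite /splice => ->. Qed.

Lemma splice_addn m x z k : splice m x z (m + k)%N = z k.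
Proof. by rewrite /splice ltnNge leq_addr addKn. Qed.

Lemma splice_shift m x z : agree m x z -> splice m x (shift m z) = z.
Proof.
move=> xz; apply/funext => k; rewrite /splice /shift; case: ltnP => km.
  exact: xz.
by rewrite subnKC.
Qed.

Lemma neq_coord x y : x <> y -> exists k, x k <> y k.
Proof.
move=> xy; apply: contrapT => /forallNP e; apply: xy; apply/funext => k.
exact: contrapT.
Qed.

Lemma homeo_mulE f h x : (f * h) x = h (f x). Proof. by []. Qed.

Lemma homeo_V f x : f^-1 (f x) = x. Proof. exact: homeo_funK. Qed.

Lemma homeo_KV f x : f (f^-1 x) = x. Proof. exact: homeo_invK. Qed.

Lemma homeo_inj f : injective f. Proof. exact: can_inj (homeo_V f). Qed.

Lemma homeo_conjE f h x : (h ^ f) x = f (h (f^-1 x)). Proof. by []. Qed.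

Lemma homeo_expS f k x : (f ^+ k.+1) x = (f ^+ k) (f x).
Proof. by rewrite expgS. Qed.

(** The label [g] acts letter by letter, so a longer source prefix lengthens the image prefix by as
    much and keeps [g]. *)
Lemma acts_atD h x m q g d :
  acts_at h x m q g -> acts_at h x (m + d)%N (q + d)%N g.
Proof.
move=> hx z xz.
have [hxz hz] := hx z (agree_le (leq_addr d m) xz).
have [_ hxx] := hx x (@agree_refl m x).
split=> [i iqd|k]; last by rewrite -!addnA hz.
have [iq|qi] := ltnP i q; first exact: hxz.
have -> : i = (q + (i - q))%N by lia.
by rewrite hxx hz xz//; lia.
Qed.

Global Arguments acts_atD [h x m q g] d _.

Lemma acts_at_agree h x y m q g :
  agree m x y -> acts_at h x m q g -> acts_at h y m q g.
Proof.
move=> xy hx z yz; have [hxz hz] := hx z (agree_trans xy yz).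
have [hxy _] := hx y xy; split=> //.
exact: agree_trans (agree_sym hxy) hxz.
Qed.

Lemma acts_at_mul f h x m q r g g' :
  acts_at f x m q g -> acts_at h (f x) q r g' ->
  acts_at (f * h) x m r (g * g').
Proof.
move=> fx hx z /fx[fxz fz]; have [hxz hz] := hx _ fxz.
by split=> // k; rewrite homeo_mulE hz permM -fz.
Qed.

Lemma acts_at_inv f x m q g :
  acts_at f x m q g -> acts_at f^-1 (f x) q m g^-1.
Proof.
move=> fx z xz.
pose w := splice m x (fun k => g^-1 (z (q + k)%N)).
have [fxw fw] := fx w (@agree_splice _ _ _).
have {}fw : f w = z.
  apply/funext => k; have [kq|qk] := ltnP k q; first by rewrite -fxw// xz.
  by rewrite -(subnKC qk) fw /w splice_addn permKV.
rewrite -fw !homeo_V; split; first exact: agree_splice.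
by move=> k; rewrite /w splice_addn fw.
Qed.

Lemma piecewise_one G : piecewise G 1.
Proof. by move=> x; exists 0%N, 0%N, 1 => // z _; split=> // k; rewrite perm1. Qed.

Lemma piecewiseM G f h : piecewise G f -> piecewise G h -> piecewise G (f * h).
Proof.
move=> fG hG x; have [m [q [g gG fx]]] := fG x.
have [m' [q' [g' g'G hx]]] := hG (f x).
(* Refining the cone at [x] by [m'] letters and the cone at [f x] by [q] letters makes the
   intermediate prefixes equally long. *)
exists (m + m')%N, (q' + q)%N, (g * g'); first by rewrite groupM.
apply: acts_at_mul (acts_atD m' fx) _.
by rewrite addnC; exact: acts_atD.
Qed.

Lemma piecewiseV G f : piecewise G f -> piecewise G f^-1.
Proof.
move=> fG y; have [m [q [g gG fx]]] := fG (f^-1 y).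
exists q, m, g^-1; first by rewrite groupV.
by have := acts_at_inv fx; rewrite homeo_KV.
Qed.

Lemma piecewiseX G f k : piecewise G f -> piecewise G (f ^+ k).
Proof.
move=> fG; elim: k => [|k IH]; first exact: piecewise_one.
by rewrite expgS; exact: piecewiseM.
Qed.

Lemma piecewiseJ G f h : piecewise G f -> piecewise G h -> piecewise G (f ^ h).
Proof. by move=> fG hG; apply: piecewiseM; [exact: piecewiseV|exact: piecewiseM]. Qed.

Lemma sub_piecewise (G H : {group 'S_n}) : G \subset H ->
  forall h, piecewise G h -> piecewise H h.
Proof.
move=> GH h hG x; have [m [q [g gG hx]]] := hG x.
by exists m, q, g => //; apply: (fintype.subsetP GH).
Qed.

Lemma piecewise_continuous G h x k : piecewise G h ->
  exists m, forall z, agree m x z -> agree k (h x) (h z).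
Proof.
move=> /(_ x)[m [q [g _ /(acts_atD k) hx]]].
by exists (m + k)%N => z /hx[+ _]; apply: agree_le; lia.
Qed.

Lemma moved_cone G h x : piecewise G h -> h x <> x ->
  exists m, forall y z, agree m x y -> agree m x z -> h y <> z.
Proof.
move=> hG /neq_coord[k hxk].
have [m hm] := piecewise_continuous x k.+1 hG.
exists (m + k.+1)%N => y z xy xz e; apply: hxk.
rewrite (hm y) ?e ?xz//; try lia.
by apply: agree_le xy; lia.
Qed.

(* Koenig's lemma. *)
Lemma uniform_prefix (P : Cantor n -> nat -> Prop) :
    (forall x m, P x m -> P x m.+1) ->
    (forall x y m, agree m x y -> P x m -> P y m) ->
    (forall x, exists m, P x m) ->
  exists M, forall x, P x M.
Proof.
move=> Pmono Pagree Pex; apply: contrapT => noM.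
have Ple x m m' : (m <= m')%N -> P x m -> P x m'.
  by move=> /subnKC <-; elim: (m' - m)%N => [|d IH Pm]; rewrite ?addn0// addnS; auto.
(* [bad x k]: no single bound serves the whole cone of the first [k] letters of [x]. A bad cone has
   a bad one-letter extension, since otherwise the largest of the finitely many bounds [N j] would
   serve it. *)
pose bad x k := forall M, exists2 y, agree k x y & ~ P y M.
have badS x k : bad x k -> exists2 x', agree k x x' & bad x' k.+1.
  move=> bx; apply: contrapT => nx.
  have /choice[N PN] : forall j : 'I_n, exists N, forall y,
      agree k x y -> y k = j -> P y N.
    move=> j; apply: contrapT => /forallNP nj; apply: nx.
    exists (splice k x (const j)); first exact: agree_splice.
    move=> N; have := nj N => /existsNP[y /not_implyP[xy /not_implyP[yj nP]]].
    exists y => // i; rewrite ltnS leq_eqVlt => /orP[/eqP ->|ik].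
      by rewrite yj /splice ltnn.
    by rewrite /splice ik xy.
  have [y xy] := bx (\max_j N j); apply; apply: (@Ple _ (N (y k))).
    exact: leq_bigmax.
  exact: PN.
have /choice[F FP] : forall s : Cantor n * nat, exists x',
    bad s.1 s.2 -> agree s.2 s.1 x' /\ bad x' s.2.+1.
  move=> [x k]; case: (pselect (bad x k)) => [/badS[x' ? ?]|nb].
    by exists x'.
  by exists x.
have noP M : exists y, ~ P y M.
  by apply: contrapT => /forallNP noy; apply: noM; exists M => x; exact: contrapT.
have [x0 _] := noP 0%N.
have bad0 : bad x0 0%N by move=> M; have [y nP] := noP M; exists y.
pose X := fix X k := if k is k'.+1 then F (X k', k') else x0.
have badX k : bad (X k) k.
  by elim: k => //= k /(FP (X k, k))[].
have XS k : agree k (X k) (X k.+1) by have [] := FP (X k, k) (badX k).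
(* The limit of the nested bad cones; a bound valid at [x] is valid on a whole cone around [x],
   which is bad. *)
pose x : Cantor n := fun k => X k.+1 k.
have Xx k : agree k (X k) x.
  elim: k => // k IH i; rewrite ltnS leq_eqVlt => /orP[/eqP -> //|ik].
  by rewrite -IH// (XS k i ik).
have [m Pm] := Pex x.
have [y Xy] := badX m m; apply.
exact: Pagree (agree_trans (agree_sym (Xx m)) Xy) Pm.
Qed.

Lemma piecewise_uniform G h : piecewise G h ->
  exists M, forall x, exists q, exists2 g, g \in G & acts_at h x M q g.
Proof.
move=> hG; apply: uniform_prefix => [x m [q [g gG hx]]|x y m xy [q [g gG hx]]|].
- by exists q.+1, g => //; have := acts_atD 1%N hx; rewrite !addn1.
- by exists q, g => //; exact: acts_at_agree hx.
- exact: hG.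
Qed.

Lemma wcat_agree (a : seq 'I_n) (u v : Cantor n) : agree (size a) (wcat a u) (wcat a v).
Proof. by move=> i ia; rewrite /wcat; exact: set_nth_default. Qed.

Lemma wcat_addn (a : seq 'I_n) (u : Cantor n) k : wcat a u (size a + k)%N = u k.
Proof. by rewrite /wcat nth_default ?leq_addr// addKn. Qed.

Lemma wcat_mkseq m x (u : Cantor n) : wcat (mkseq x m) u = splice m x u.
Proof.
apply/funext => k; rewrite /wcat /splice size_mkseq; case: ltnP => km.
  by rewrite nth_mkseq.
by rewrite nth_default ?size_mkseq.
Qed.

Lemma cone_agree (a : seq 'I_n) u x : agree (size a) (wcat a u) x <-> cone a x.
Proof.
split=> [ax|[v _ <-]]; last exact: wcat_agree.
exists (shift (size a) x) => //; rewrite -[RHS](splice_shift ax).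
apply/funext => k; rewrite /splice; case: ltnP => ka; first exact: wcat_agree.
by rewrite /wcat nth_default.
Qed.

Lemma cone_mkseq x m z : cone (mkseq x m) z <-> agree m x z.
Proof.
by rewrite -(cone_agree _ (shift m x)) size_mkseq wcat_mkseq splice_shift.
Qed.

Lemma acts_at_wcat h (a b : seq 'I_n) g :
  (forall u, h (wcat a u) = wcat b (fun k => g (u k))) ->
  forall u, acts_at h (wcat a u) (size a) (size b) g.
Proof.
move=> hab u z /cone_agree[w _ <-]; rewrite !hab.
by split=> [|k]; [exact: wcat_agree|rewrite !wcat_addn].
Qed.

Lemma HigmanThompson_piecewise h : HigmanThompson n h -> piecewise 1 h.
Proof.
move=> [t [a [b [[acover _ _] _ hab]]]] x.
have : [set: Cantor n]%classic x by [].
rewrite -acover => -[i _ [u _ <-]].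
exists (size (a i)), (size (b i)), 1; first exact: group1.
by apply: acts_at_wcat => v; rewrite hab; congr wcat; apply/funext => k; rewrite perm1.
Qed.

Lemma acts_at_id h x m : (forall z, agree m x z -> h z = z) -> acts_at h x m m 1.
Proof. by move=> hid z xz; rewrite !hid//; split=> // k; rewrite perm1. Qed.

Lemma iterperm_piecewise G a g : g \in G -> piecewise G (iterperm a g).
Proof.
move=> gG x; exists (size a), (size a).
case: (pselect (cone a x)) => [[u _ <-]|ax].
  by exists g => //; apply: acts_at_wcat => v; exact: iterperm_wcat.
exists 1; rewrite ?group1//; apply: acts_at_id => z xz.
apply: iterperm_out => -[u _ e]; apply: ax; apply/(cone_agree _ u).
by rewrite e; exact: agree_sym.
Qed.

Lemma piecewise_HigmanThompson h : (0 < n)%N -> piecewise 1 h -> HigmanThompson n h.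
Proof.
move=> n_gt0 /piecewise_uniform[M hM].
have {hM} /choice[q hq] : forall x, exists q, acts_at h x M q 1.
  by move=> x; have [q [g /set1P -> hx]] := hM x; exists q.
pose x0 := const (Ordinal n_gt0).
(* The words of length [M] give the source partition. The target words are read off at the images of
   the points [wcat (a i) x0]; bijectivity of [h] makes their cones a partition. *)
pose a (i : 'I_#|{: M.-tuple 'I_n}|) : seq 'I_n := enum_val i.
have sa i : size (a i) = M by rewrite size_tuple.
pose b i := mkseq (h (wcat (a i) x0)) (q (wcat (a i) x0)).
have hab i u : h (wcat (a i) u) = wcat (b i) u.
  have [|hau hu] := hq (wcat (a i) x0) (wcat (a i) u).
    by rewrite -{1}(sa i); exact: wcat_agree.
  rewrite wcat_mkseq -(splice_shift hau); congr splice.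
  by apply/funext => k; rewrite /shift hu perm1 -{1}(sa i) wcat_addn.
have acover x : exists i, cone (a i) x.
  have sx : size (mkseq x M) == M by rewrite size_mkseq.
  by exists (enum_rank (Tuple sx)); rewrite /a enum_rankK; apply/cone_mkseq.
have adisj i j x : cone (a i) x -> cone (a j) x -> i = j.
  move=> /coneP ei /coneP ej; apply: enum_val_inj; apply: val_inj => /=.
  by rewrite -[LHS]ei -[RHS]ej !size_tuple.
exists _, a, b; split=> //; split.
- by rewrite -subTset => x _; have [i ix] := acover x; exists i.
- by move=> i j _ _ [x [ix jx]]; exact: adisj ix jx.
- by move=> i _; exists (wcat (a i) x0), x0.
- rewrite -subTset => x _; have [i [u _ iu]] := acover (h^-1 x); exists i => //.
  by exists u; rewrite // -hab iu homeo_KV.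
- move=> i j _ _ [x [[u _ iu] [v _ jv]]].
  apply: (adisj _ _ (h^-1 x)); [exists u|exists v] => //.
    by rewrite -iu -hab homeo_V.
  by rewrite -jv -hab homeo_V.
- by move=> i _; exists (wcat (b i) x0), x0.
Qed.

Lemma HigmanThompsonE : (0 < n)%N -> HigmanThompson n = piecewise 1.
Proof.
move=> n0; apply/seteqP; split=> h; first exact: HigmanThompson_piecewise.
exact: piecewise_HigmanThompson.
Qed.

Lemma piecewise_closed G : group_closed [in piecewise G].
Proof.
split; first by rewrite inE; exact: piecewise_one.
by move=> f h; rewrite !inE => fG hG; apply: piecewiseM => //; exact: piecewiseV.
Qed.

Lemma piecewise_generated G h : (0 < n)%N -> piecewise G h -> HigmanThompson_ext G h.
Proof.
move=> n0 hG A [Acl subA].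
have AM f v : A f -> A v -> A (f * v).
  by move=> fA vA; apply: set_mem; apply: (group_closedM Acl); exact: mem_set.
have [M hM] := piecewise_uniform hG.
(* Induction on a list [s] of words outside which all labels are trivial. Premultiplying [f] by
   [iterperm a g^-1] preserves prefixes of length [M] and cancels the label on the cone of [a]; an
   empty list leaves an element of [V_n]. *)
have ind (s : seq (seq 'I_n)) f : (forall x, exists q, exists2 g, g \in G &
    acts_at f x M q g /\ (mkseq x M \notin s -> g = 1)) -> A f.
  elim: s f => [|a s IH] f fM.
    apply: subA; left; rewrite HigmanThompsonE// => x.
    have [q [g gG [fx /(_ isT) g1]]] := fM x.
    by exists M, q, 1; rewrite ?group1// -g1.
  case: (pselect (exists x, mkseq x M = a)) => [[x xa]|nx]; last first.
    apply: IH => x; have [q [g gG [fx g1]]] := fM x.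
    exists q, g => //; split=> // xs; apply: g1; rewrite inE negb_or xs andbT.
    by apply: contra_notN nx => /eqP xa; exists x.
  have sa : size a = M by rewrite -xa size_mkseq.
  have [q [g gG [fx _]]] := fM x.
  have kE : (iterperm a g)^-1 = iterperm a g^-1 by exact: homeoP.
  rewrite -[f]mul1g -(mulgV (iterperm a g)) -mulgA kE.
  apply: AM; first by apply: subA; right; exists a, g.
  apply: IH => y; case: (pselect (cone a y)) => [[u _ <-]|ay].
    exists q, 1; rewrite ?group1//; split=> //; rewrite -(mulVg g).
    apply: (@acts_at_mul _ _ _ _ M).
      by rewrite -sa; apply: acts_at_wcat => v; exact: iterperm_wcat.
    apply: acts_at_agree fx; apply/cone_mkseq; rewrite xa iterperm_wcat.
    by eexists.
  have [r [g' g'G [fy g'1]]] := fM y.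
  exists r, g' => //; split.
    rewrite -[g']mul1g; apply: (@acts_at_mul _ _ _ _ M); last by rewrite iterperm_out.
    apply: acts_at_id => z yz; apply: iterperm_out; rewrite -xa => /cone_mkseq xz.
    by apply: ay; rewrite -xa; apply/cone_mkseq; apply: agree_trans xz (agree_sym yz).
  move=> ys; apply: g'1; rewrite inE negb_or ys andbT; apply/eqP => ya.
  by apply: ay; rewrite -ya; exact/cone_mkseq.
apply: (ind (map (@tval M 'I_n) (enum {: M.-tuple 'I_n}))) => x.
have [q [g gG hx]] := hM x; exists q, g => //; split=> // /negP[].
have sx : size (mkseq x M) == M by rewrite size_mkseq.
by apply/mapP; exists (Tuple sx); rewrite ?mem_enum.
Qed.

Lemma HigmanThompson_extE G : (0 < n)%N -> HigmanThompson_ext G = piecewise G.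
Proof.
move=> n0; apply/seteqP; split=> h; last exact: piecewise_generated.
apply; split; first exact: piecewise_closed.
move=> v [/HigmanThompson_piecewise|[a [g gG ->]]].
  by apply: sub_piecewise; exact: sub1G.
exact: iterperm_piecewise.
Qed.

End LocalAction.

(** * Semiregular groups: recoding by a cocycle *)

Section Cocycle.
Context {n : nat}.
Implicit Types (x y z : Cantor n) (g : 'S_n) (G : {group 'S_n}).

(** Fix a representative in each orbit; by freeness exactly one element of [G] carries it to [i],
    and this is [lam i]. *)
Lemma semiregular_cocycle G : semiregular_perm G ->
  exists lam : 'I_n -> 'S_n,
    (forall i, lam i \in G) /\ (forall g i, g \in G -> lam (g i) = lam i * g).
Proof.
move=> Gfree.
have Ginj g h (i : 'I_n) : g \in G -> h \in G -> g i = h i -> g = h.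
  move=> gG hG ghi; apply/eqP; rewrite eq_mulgV1; apply: contraT => gh.
  have /negP[] := Gfree _ (groupM gG (groupVr hG)) gh i.
  by rewrite permM ghi permK.
pose orb (i : 'I_n) := [set (g : 'S_n) i | g in G]%SET.
have orbJ g i : g \in G -> orb (g i) = orb i.
  move=> gG; apply/setP => j; apply/imsetP/imsetP => -[h hG ->].
    by exists (g * h); rewrite ?permM ?groupM.
  by exists (g^-1 * h); rewrite ?permM ?permK ?groupM ?groupV.
(* The default is never taken, as [i] lies in its own orbit; hence [rep i] depends on the orbit
   only. *)
pose rep i := odflt i [pick j in orb i].
have repP i : exists2 g, g \in G & g (rep i) = i.
  rewrite /rep; case: pickP => [j /imsetP[g gG ->]|/(_ i)/negP[]].
    by exists g^-1; rewrite ?groupV// permK.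
  by apply/imsetP; exists 1; rewrite ?perm1.
have repJ g i : g \in G -> rep (g i) = rep i.
  rewrite /rep => gG; rewrite orbJ//; case: pickP => // /(_ i)/negP[].
  by apply/imsetP; exists 1; rewrite ?perm1.
pose lam i := odflt 1 [pick g in G | g (rep i) == i].
have lamP i : lam i \in G /\ lam i (rep i) = i.
  rewrite /lam; case: pickP => [g /andP[gG /eqP]//|/= nog].
  by have [g gG gi] := repP i; have := nog g; rewrite gG gi eqxx.
exists lam; split=> [i|g i gG]; first by have [] := lamP i.
have [lgG lg] := lamP (g i); have [lG l] := lamP i.
by apply: (@Ginj _ _ (rep i)) => //; rewrite ?groupM// permM l -(repJ g).
Qed.

Section Recoding.
Variables (G : {group 'S_n}) (lam : 'I_n -> 'S_n).
Hypothesis lamG : forall i, lam i \in G.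
Hypothesis lamM : forall g i, g \in G -> lam (g i) = lam i * g.

Definition recode x : Cantor n :=
  fun k => if k is k'.+1 then (lam (x k'))^-1 (x k) else x k.

Fixpoint decode_fun (y : nat -> 'I_n) k : 'I_n :=
  if k is k'.+1 then lam (decode_fun y k') (y k) else y k.

Definition decode y : Cantor n := decode_fun y.

Lemma recodeK : cancel recode decode.
Proof.
move=> x; apply/funext; elim=> [|k IH] //=.
rewrite /decode /= in IH *; rewrite IH /recode.
by rewrite permKV.
Qed.

Lemma decodeK : cancel decode recode.
Proof. by move=> y; apply/funext; case=> [|k] //=; rewrite /decode /= permK. Qed.

Lemma recode_agree m x y : agree m x y -> agree m (recode x) (recode y).
Proof.
by move=> xy [|i] im; rewrite /recode /= ?xy//; exact: ltnW.
Qed.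

Lemma decode_agree m x y : agree m x y -> agree m (decode x) (decode y).
Proof.
move=> xy; elim=> [|i IH] im; first exact: xy.
by rewrite /decode /= -!/(decode _ _) (IH (ltnW im)) xy.
Qed.

Lemma agree_continuous (F : Cantor n -> Cantor n) :
  (forall m x y, agree m x y -> agree m (F x) (F y)) -> continuous F.
Proof.
by move=> FP; apply: Cantor_continuous => k; exists k.+1 => x y /FP; apply.
Qed.

Definition recoding : homeo (Cantor n) :=
  Homeo recodeK decodeK (agree_continuous recode_agree)
    (agree_continuous decode_agree).

Lemma recode_piecewise v : piecewise G v -> piecewise 1 (v ^ recoding).
Proof.
move=> vG y; have [m [q [g gG vx]]] := vG (decode y).
(* The first letter after the prefix may still show [g] once recoded, so it is moved into the
   prefix; from the next one on, [lamM] makes [g] cancel. *)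
exists (m + 1)%N, (q + 1)%N, 1; rewrite ?group1// => z' /decode_agree yz.
rewrite !homeo_conjE; split.
  by apply: recode_agree; have [] := acts_atD 1%N vx _ yz.
have [_ vz] := vx _ (agree_le (leq_addr 1 m) yz).
move=> k; rewrite perm1 -[in RHS](decodeK z') -!addnA !add1n.
rewrite !addnS -[LHS]/((lam (v (decode z') (q + k)))^-1 (v (decode z') (q + k).+1)).
rewrite -[RHS]/((lam (decode z' (m + k)))^-1 (decode z' (m + k).+1)).
by rewrite -addnS !vz addnS lamM// invMg permM permK.
Qed.

Lemma decode_piecewise v : piecewise 1 v -> piecewise G (v ^ recoding^-1).
Proof.
move=> vG x; have [m [q [g /set1P -> vx]]] := vG (recode x).
pose w := (v ^ recoding^-1) x.
(* The label is the quotient of the two values of [lam] at the last letters of the prefixes. By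
   [step] and [lamM] this quotient reproduces itself from each letter to the next, which is
   [mulE]. *)
exists (m + 1)%N, (q + 1)%N, ((lam (x m))^-1 * lam (w q)).
  by rewrite groupM ?groupV ?lamG.
move=> z xz.
have xz' := recode_agree xz.
have wz : agree (q + 1) w ((v ^ recoding^-1) z).
  by apply: decode_agree; have [] := acts_atD 1%N vx _ xz'.
split=> //.
have [_ vz] := vx _ (agree_le (leq_addr 1 m) xz').
have decS y k : decode y k.+1 = lam (decode y k) (y k.+1) by [].
have step k : (v ^ recoding^-1) z (q + k).+1 =
    ((lam (z (m + k)%N))^-1 * lam ((v ^ recoding^-1) z (q + k)%N)) (z (m + k).+1).
  rewrite permM -[LHS]/(decode (v (recode z)) (q + k).+1) decS.
  by rewrite -[(q + k).+1]addnS vz perm1 addnS.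
have xm : x m = z m by apply: xz; rewrite addn1.
have wq : w q = (v ^ recoding^-1) z q by apply: wz; rewrite addn1.
have mulE k : (lam (z (m + k)%N))^-1 * lam ((v ^ recoding^-1) z (q + k)%N) =
    (lam (x m))^-1 * lam (w q).
  elim: k => [|k IH]; first by rewrite !addn0 xm wq.
  by rewrite !addnS step lamM ?groupM ?groupV// mulKg IH.
by move=> k; rewrite -!addnA !add1n !addnS step mulE.
Qed.

Lemma recoding_isomorphic : isomorphic (piecewise G) (piecewise (1 : {group 'S_n})).
Proof.
exists (conjg^~ recoding); split=> [f h _ _|]; first by rewrite conjMg.
split=> [f|f h _ _|h h1]; first exact: recode_piecewise.
  exact: conjg_inj.
by exists (h ^ recoding^-1); [exact: decode_piecewise|rewrite conjgKV].
Qed.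

End Recoding.
End Cocycle.

(** * Elements with small support *)

Section Swaps.
Context {n : nat}.
Implicit Types (x y z p q : Cantor n) (i j : 'I_n) (G : {group 'S_n}).

Definition swap_fun p m q r z : Cantor n :=
  if `[< agree m p z >] then splice r q (shift m z)
  else if `[< agree r q z >] then splice m p (shift r z) else z.

Lemma swap_fun_continuous p m q r : continuous (swap_fun p m q r).
Proof.
apply: Cantor_continuous => k; exists (m + r + k).+1 => x y xy.
have agreeE l u : (l <= m + r)%N -> `[< agree l u x >] = `[< agree l u y >].
  move=> lmr; have {}xy : agree l x y by apply: agree_le xy; lia.
  by apply: asbool_equiv_eq; split=> ux; apply: agree_trans ux _ => //;
    exact: agree_sym.
rewrite /swap_fun !agreeE ?leq_addr ?leq_addl// /splice /shift.
by do 2?[case: ifP => _]; rewrite ?[in LHS]xy//; lia.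
Qed.

(** Exchanging the prefixes of two disjoint cones is an involution with trivial labels, so it is
    available for every [G]. *)
Lemma swap_exists G p m q r :
  (forall z, agree m p z -> ~ agree r q z) ->
  exists v, [/\ piecewise G v,
    forall z, agree m p z -> v z = splice r q (shift m z),
    forall z, agree r q z -> v z = splice m p (shift r z) &
    forall z, ~ agree m p z -> ~ agree r q z -> v z = z].
Proof.
move=> disj; pose F := swap_fun p m q r.
have Fp z : agree m p z -> F z = splice r q (shift m z).
  by move=> pz; rewrite /F /swap_fun asboolT.
have Fq z : agree r q z -> F z = splice m p (shift r z).
  move=> qz; rewrite /F /swap_fun asboolF ?asboolT// => pz.
  exact: disj pz qz.
have Fo z : ~ agree m p z -> ~ agree r q z -> F z = z.
  by move=> pz qz; rewrite /F /swap_fun !asboolF.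
have shift_splice l u w : shift l (splice l u w) = w :> Cantor n.
  by apply/funext => k; rewrite /shift splice_addn.
have FK : cancel F F.
  move=> z; have [pz|pz] := pselect (agree m p z).
    by rewrite (Fp _ pz) Fq ?shift_splice ?splice_shift//; exact: agree_splice.
  have [qz|qz] := pselect (agree r q z).
    by rewrite (Fq _ qz) Fp ?shift_splice ?splice_shift//; exact: agree_splice.
  by rewrite !(Fo z).
pose v := Homeo FK FK (@swap_fun_continuous p m q r) (@swap_fun_continuous p m q r).
exists v; split=> // z.
have [pz|pz] := pselect (agree m p z).
  exists m, r, 1; rewrite ?group1// => w zw; have pw := agree_trans pz zw.
  rewrite /= !Fp//; split=> [|k]; last by rewrite splice_addn perm1.
  by move=> k kr; rewrite /splice kr.
have [qz|qz] := pselect (agree r q z).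
  exists r, m, 1; rewrite ?group1// => w zw; have qw := agree_trans qz zw.
  rewrite /= !Fq//; split=> [|k]; last by rewrite splice_addn perm1.
  by move=> k kr; rewrite /splice kr.
exists (m + r)%N, (m + r)%N, 1; rewrite ?group1//; apply: acts_at_id => w /agree_sym zw.
by apply: Fo => uw; [apply: pz|apply: qz]; apply: agree_trans uw (agree_le _ zw);
  rewrite ?leq_addr ?leq_addl.
Qed.

Lemma other_letter i : (2 <= n)%N -> exists j, j <> i.
Proof.
move=> n2; have n0 : (0 < n)%N by lia.
by case: (eqVneq (val i) 0%N) => i0; [exists (Ordinal n2)|exists (Ordinal n0)] => ji;
  rewrite -ji in i0.
Qed.

(* With [c] the first [m] letters of [x], the product of the swap of [c i] with
   [c j i] and the swap of [c j] with [c i i] maps [c i u] to [c i i i u]. *)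
Lemma shifter_exists G x m i : (2 <= n)%N -> exists s, [/\ piecewise G s,
    forall z, ~ agree m x z -> s z = z &
    forall k z e, agree m x z -> z m = i -> z (m + e)%N <> i -> (s ^+ k.+1) z <> z].
Proof.
move=> n2; have [j ji] := other_letter i n2.
pose C := splice m x (const i); pose D := splice m x (const j).
pose J := splice m x (splice 1 (const j) (const i)).
have Cm k : C (m + k)%N = i by rewrite /C splice_addn.
have Dm k : D (m + k)%N = j by rewrite /D splice_addn.
have Jm k : J (m + k)%N = if k is 0 then j else i.
  by rewrite /J splice_addn /splice; case: k.
have Cm0 : C m = i by have := Cm 0%N; rewrite addn0.
have Dm0 : D m = j by have := Dm 0%N; rewrite addn0.
have Jm0 := Jm 0%N; rewrite addn0 in Jm0.
have xC : agree m x C by exact: agree_splice.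
have xD : agree m x D by exact: agree_splice.
have xJ : agree m x J by exact: agree_splice.
clearbody C D J.
have [s1 [s1G s1C _ s1o]] : exists v, [/\ piecewise G v,
    forall z, agree (m + 1) C z -> v z = splice (m + 2) J (shift (m + 1) z),
    forall z, agree (m + 2) J z -> v z = splice (m + 1) C (shift (m + 2) z) &
    forall z, ~ agree (m + 1) C z -> ~ agree (m + 2) J z -> v z = z].
  apply: swap_exists => z Cz Jz; apply: ji.
  by rewrite -(Jm 0%N) -(Cm 0%N) Cz ?Jz//; lia.
have [s2 [s2G s2D _ s2o]] : exists v, [/\ piecewise G v,
    forall z, agree (m + 1) D z -> v z = splice (m + 2) C (shift (m + 1) z),
    forall z, agree (m + 2) C z -> v z = splice (m + 1) D (shift (m + 2) z) &
    forall z, ~ agree (m + 1) D z -> ~ agree (m + 2) C z -> v z = z].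
  apply: swap_exists => z Dz Cz; apply: ji.
  by rewrite -(Dm 0%N) -(Cm 0%N) Dz ?Cz//; lia.
have sub k u z : agree m x u -> agree (m + k) u z -> agree m x z.
  by move=> xu uz; apply: agree_trans xu (agree_le (leq_addr k m) uz).
have sE z : agree m x z -> z m = i -> (s1 * s2) z = splice (m + 2) C (shift m z).
  move=> xz zi; rewrite homeo_mulE s1C; last first.
    move=> k; rewrite addn1 ltnS leq_eqVlt => /orP[/eqP ->|km].
      by rewrite Cm0.
    by rewrite -xC// xz.
  rewrite s2D; last first.
    move=> k; rewrite addn1 ltnS leq_eqVlt => /orP[/eqP ->|km].
      by rewrite splice_lt ?Dm0 ?Jm0 //; lia.
    by rewrite splice_lt -?xD ?xJ//; lia.
  congr splice; apply/funext => -[|k].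
    by rewrite /shift addn0 /splice ifT ?addn0 ?Jm ?zi//; lia.
  rewrite /shift /splice ifF; last by lia.
  by congr (z _); lia.
(* Each application inserts two more letters [i] after the first [m] letters. *)
have sXE k z : agree m x z -> z m = i ->
    ((s1 * s2) ^+ k) z = splice (m + k.*2) C (shift m z).
  elim: k z => [|k IH] z xz zi.
    rewrite expg0 double0 addn0; apply/funext => t; rewrite /= /splice /shift.
    by case: ltnP => tm; [rewrite -xC// xz|congr (z _); lia].
  rewrite homeo_expS sE// IH; last first.
  - by rewrite splice_lt ?Cm0 //; lia.
  - exact: (sub 2%N C _ xC (@agree_splice _ _ _ _)).
  apply/funext => t; rewrite /splice /shift.
  have [tk|kt] := ltnP t (m + k.*2); first by rewrite ifT//; lia.
  have [tk|{}kt] := ltnP t (m + k.+1.*2).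
    rewrite ifT; last by lia.
    by rewrite Cm -(subnKC (leq_trans (leq_addr k.*2 m) kt)) Cm.
  rewrite ifF; last by lia.
  by congr (z _); lia.
exists (s1 * s2); split; first exact: piecewiseM.
  have xo k u z : agree m x u -> ~ agree m x z -> ~ agree (m + k) u z.
    by move=> xu xz /(sub k u z xu).
  by move=> z xz; rewrite homeo_mulE s1o ?s2o//; exact: xo.
(* If the power fixed [z], each letter from position [m] on would be [i] or repeat the letter
   [k.+1.*2] places earlier, so all of them would be [i]. *)
move=> k z e xz zi zme sz; apply: zme.
elim/ltn_ind: e => e IH.
rewrite -sz sXE// /splice; case: ltnP => e2.
  by rewrite Cm.
rewrite /shift -[RHS](IH (e - k.+1.*2)%N); last by lia.
congr (z _); lia.
Qed.

(** With [c] the first [m] letters of [x], [f1] swaps the cones of [c i i] and [c i j], and [f2]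
    those of [c i] and [c j]. The images of [c i i i ...] under the two products differ at position
    [m + 1]. *)
Lemma noncommuting_exists G x m : (2 <= n)%N -> exists f1 f2 z,
  [/\ piecewise G f1, piecewise G f2,
    forall y, ~ agree m x y -> f1 y = y, forall y, ~ agree m x y -> f2 y = y &
    agree m x z /\ f1 (f2 z) <> f2 (f1 z)].
Proof.
move=> n2; have n0 : (0 < n)%N by lia.
pose i := Ordinal n0; have [j ji] := other_letter i n2.
pose C := splice m x (const i); pose D := splice m x (const j).
pose J := splice m x (splice 1 (const i) (const j)).
have Cm k : C (m + k)%N = i by rewrite /C splice_addn.
have Dm k : D (m + k)%N = j by rewrite /D splice_addn.
have Jm k : J (m + k)%N = if k is 0 then i else j.
  by rewrite /J splice_addn /splice; case: k.
have Cm0 : C m = i by have := Cm 0%N; rewrite addn0.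
have Dm0 : D m = j by have := Dm 0%N; rewrite addn0.
have Jm0 := Jm 0%N; rewrite addn0 in Jm0.
have xC : agree m x C by exact: agree_splice.
have xD : agree m x D by exact: agree_splice.
have xJ : agree m x J by exact: agree_splice.
clearbody C D J.
have sub k u z : agree m x u -> agree (m + k) u z -> agree m x z.
  by move=> xu uz; apply: agree_trans xu (agree_le (leq_addr k m) uz).
have [f1 [f1G f1C _ f1o]] : exists v, [/\ piecewise G v,
    forall z, agree (m + 2) C z -> v z = splice (m + 2) J (shift (m + 2) z),
    forall z, agree (m + 2) J z -> v z = splice (m + 2) C (shift (m + 2) z) &
    forall z, ~ agree (m + 2) C z -> ~ agree (m + 2) J z -> v z = z].
  apply: swap_exists => z Cz Jz; apply: ji.
  by rewrite -(Jm 1%N) -(Cm 1%N) Cz ?Jz//; lia.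
have [f2 [f2G f2C _ f2o]] : exists v, [/\ piecewise G v,
    forall z, agree (m + 1) C z -> v z = splice (m + 1) D (shift (m + 1) z),
    forall z, agree (m + 1) D z -> v z = splice (m + 1) C (shift (m + 1) z) &
    forall z, ~ agree (m + 1) C z -> ~ agree (m + 1) D z -> v z = z].
  apply: swap_exists => z Cz Dz; apply: ji.
  by rewrite -(Dm 0%N) -(Cm 0%N) Dz ?Cz//; lia.
exists f1, f2, C; split=> // [y xy|y xy|].
- by apply: f1o => uy; apply: xy; apply: sub uy.
- by apply: f2o => uy; apply: xy; apply: sub uy.
split=> // /(congr1 (fun y => y (m + 1)%N)).
have f2C' : f2 C = splice (m + 1) D (shift (m + 1) C) by apply: f2C.
rewrite (f1o (f2 C)); first last.
- move=> /(_ m); rewrite f2C' splice_lt ?Jm0 ?Dm0; try lia.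
  by move=> ij; apply: ji; rewrite ij//; lia.
- move=> /(_ m); rewrite f2C' splice_lt ?Cm0 ?Dm0; try lia.
  by move=> ij; apply: ji; rewrite ij//; lia.
rewrite f2C' (f1C C)// f2C; last first.
  move=> k km; rewrite splice_lt; last by lia.
  move: km; rewrite addn1 ltnS leq_eqVlt => /orP[/eqP ->|km].
    by rewrite Cm0 Jm0.
  by rewrite -xC// xJ.
have at0 u w : splice (m + 1) u w (m + 1)%N = w 0%N by rewrite /splice ltnn subnn.
rewrite !at0 /shift addn0 Cm splice_lt; last by lia.
by rewrite Jm => /esym.
Qed.

End Swaps.

(** * Algebraic disjointness *)

(** An algebraic substitute for disjointness of the supports of [a] and [b]: products and
    commutators in [A] suffice to state it, so isomorphisms preserve it. *)
Definition alg_disjoint (X : groupType) (A : set X) (a b : X) :=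
  forall h, A h -> ~ commute a h -> exists f1 f2,
    [/\ A f1, A f2, commute f1 b, commute f2 b &
        commute [~ f1, [~ f2, h]] b /\ [~ f1, [~ f2, h]] <> 1].

Section Rubin.
Context {n : nat}.
Hypothesis n2 : (2 <= n)%N.
Implicit Types (x y z : Cantor n) (a b f h : homeo (Cantor n))
  (G : {group 'S_n}).

Lemma commuteE f h : commute f h <-> forall x, h (f x) = f (h x).
Proof.
split=> [e x|e]; first by rewrite -!homeo_mulE e.
by apply: homeoP => x; rewrite !homeo_mulE e.
Qed.

Lemma homeo_neq1 f : f <> 1 -> exists x, f x <> x.
Proof.
move=> f1; apply: contrapT => /forallNP fid; apply: f1; apply: homeoP => x.
exact: contrapT.
Qed.

Lemma homeo_fixV f x : f x = x -> f^-1 x = x.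
Proof. by move=> e; rewrite -[in LHS]e homeo_V. Qed.

Lemma homeo_fixX f k x : f x = x -> (f ^+ k) x = x.
Proof. by move=> e; elim: k => // k IH; rewrite homeo_expS e. Qed.

Lemma homeo_commgE f h x : [~ f, h] x = h (f (h^-1 (f^-1 x))).
Proof. by []. Qed.

Lemma commg_moved f h x : [~ f, h] x <> x -> h x <> x \/ h (f^-1 x) <> f^-1 x.
Proof.
move=> c; apply: contrapT => /not_orP[/contrapT hx /contrapT hfx]; apply: c.
by rewrite homeo_commgE homeo_fixV// homeo_KV.
Qed.

(** As [h] does not commute with [a], both move some [x]. Take a cone [U] around [x] that [h] maps
    off itself and whose points are all moved by [a], hence fixed by [b]. For [f1], [f2] supported
    in [U], [[~ f2, h]] is [f2^-1] on [U], so the double commutator is supported in [U] and acts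
    there as [[~ f1, f2^-1]]. *)
Lemma alg_disjoint_of_supports G a b : piecewise G a ->
  (forall x, a x = x \/ b x = x) -> alg_disjoint (piecewise G) a b.
Proof.
move=> aG ab h hG ah.
have [x [ax hx]] : exists x, a x <> x /\ h x <> x.
  apply: contrapT => nx; apply: ah; apply/commuteE => x.
  have {}nx y : a y <> y -> h y = y.
    by move=> ay; apply: contrapT => hy; apply: nx; exists y.
  have [axx|axx] := pselect (a x = x); last first.
    by rewrite (nx x axx) nx// => /homeo_inj.
  rewrite axx; apply: esym; apply: contrapT => ahx.
  by have /homeo_inj hhx := nx _ ahx; apply: ahx; rewrite hhx.
have [m1 am] := moved_cone aG ax; have [m2 hm] := moved_cone hG hx.
pose m := maxn m1 m2.
have {}am y : agree m x y -> a y <> y.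
  by move=> xy; apply: am; apply: agree_le xy; exact: leq_maxl.
have {}hm y : agree m x y -> ~ agree m x (h y).
  by move=> xy xhy; apply: (hm y (h y)) => //; apply: agree_le (leq_maxr m1 m2) _.
have [f1 [f2 [z [f1G f2G f1o f2o [xz f12]]]]] := noncommuting_exists G x m n2.
have fixb f : (forall y, ~ agree m x y -> f y = y) -> commute f b.
  move=> fo; apply/commuteE => y.
  have bm u : agree m x u -> b u = u by move=> xu; have [/(am _ xu)|] := ab u.
  have [xy|xy] := pselect (agree m x y).
    rewrite (bm y)// bm//; apply: contrapT => xfy; apply: xfy.
    apply: contrapT => xfy; have /homeo_inj e := fo _ xfy.
    by apply: xfy; rewrite e.
  rewrite (fo y)// fo// => xby; apply: xy.
  by have /homeo_inj e := bm _ xby; rewrite -e.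
have hV y : agree m x y -> ~ agree m x (h^-1 y).
  by move=> xy /hm; rewrite homeo_KV.
have in_fix f : (forall y, ~ agree m x y -> f y = y) ->
    forall y, agree m x y -> agree m x (f y).
  move=> fo y xy; apply: contrapT => xfy; have /homeo_inj e := fo _ xfy.
  by apply: xfy; rewrite e.
have fixV f : (forall y, ~ agree m x y -> f y = y) ->
    forall y, ~ agree m x y -> f^-1 y = y.
  by move=> fo y xy; apply: homeo_fixV; apply: fo.
pose q := [~ f2, h].
have qin y : agree m x y -> q y = f2^-1 y.
  move=> xy; rewrite /q homeo_commgE f2o ?homeo_KV//.
  by apply: hV; apply: in_fix xy; exact: fixV.
exists f1, f2; split=> //; try exact: fixb.
split.
  apply: fixb => y xy; rewrite homeo_commgE -/q (fixV f1)//.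
  have xqy : ~ agree m x (q^-1 y).
    move=> /[dup] xqy /qin; rewrite homeo_KV => e; apply: xy; rewrite e.
    by apply: in_fix xqy; exact: fixV.
  by rewrite f1o// homeo_KV.
(* At [f1 z] the double commutator takes the value [f2^-1 (f1 (f2 z))], which differs from [f1 z] by
   the choice of [z]. *)
rewrite -/q => /(congr1 (fun v : homeo (Cantor n) => v (f1 z))).
rewrite homeo_commgE homeo_V.
have -> : q^-1 z = f2 z.
  by rewrite -[in LHS](homeo_V f2 z) -qin ?homeo_V//; exact: in_fix.
rewrite qin => [/(congr1 f2)|]; first by rewrite homeo_KV.
exact: (in_fix _ f1o _ (in_fix _ f2o _ xz)).
Qed.


(* The points [y0], [y0 b], ..., [y0 b^4] are moved by [k := [~ f1, [~ f2, h]]],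
   which moves only points of the four images of a cone [U] under
   [1], [f1], [f2] and [f2 f1]; two of them lie in the same image, which
   commutation with [b] turns into a point of [U] whose image under some
   [b^d], [0 < d < 5], is in [U] again. *)
Lemma supports_of_alg_disjoint G a b : piecewise G a -> piecewise G b ->
  alg_disjoint (piecewise G) a b -> forall x, a x = x \/ (b ^+ 12) x = x.
Proof.
move=> aG bG ab x; apply: contrapT => /not_orP[ax b12].
have [m0 am] := moved_cone aG ax.
have /choice[N bN] : forall d : 'I_4, exists m, forall y z,
    agree m x y -> agree m x z -> (b ^+ d.+1) y <> z.
  move=> d; apply: moved_cone (piecewiseX _ bG) _ => bdx; apply: b12.
  (* [12] is the least common multiple of [1], [2], [3], [4], the possible differences of exponents
     among five points. *)
  have /dvdnP[c ->] : d.+1 %| 12 by case: d {bdx} => -[|[|[|[|]]]].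
  by rewrite mulnC expgM; exact: homeo_fixX.
pose m := maxn m0 (\max_d N d).
have {}am y z : agree m x y -> agree m x z -> a y <> z.
  by move=> xy xz; apply: am; [apply: agree_le xy|apply: agree_le xz]; exact: leq_maxl.
have {}bN d y : (0 < d < 5)%N -> agree m x y -> ~ agree m x ((b ^+ d) y).
  move=> d5 xy xz; have d4 : (d.-1 < 4)%N by lia.
  have Nm : (N (Ordinal d4) <= m)%N.
    by rewrite leq_max orbC; apply/orP; left; exact: leq_bigmax.
  have := bN (Ordinal d4) y ((b ^+ d) y) (agree_le Nm xy) (agree_le Nm xz).
  by apply; rewrite /= prednK//; lia.
(* A non-trivial [h] supported in [U] cannot commute with [a], because [a] maps [U] off itself. *)
have [h [h' [z [hG _ ho _ [xz hh']]]]] := noncommuting_exists G x m n2.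
have hin y : h y <> y -> agree m x y by move=> hy; apply: contrapT => /ho.
have [y hy] : exists y, h y <> y.
  apply: homeo_neq1 => h1; apply: hh'; rewrite h1; reflexivity.
have [f1 [f2 [f1G f2G f1b f2b [kb /homeo_neq1[y0 ky0]]]]] : exists f1 f2,
    [/\ piecewise G f1, piecewise G f2, commute f1 b, commute f2 b &
      commute [~ f1, [~ f2, h]] b /\ [~ f1, [~ f2, h]] <> 1].
  apply: ab => // /commuteE ah; have xy := hin y hy; apply: hy.
  by apply: (@homeo_inj _ a); rewrite -ah ho// => /(am y _ xy).
pose w (e : bool * bool) : homeo (Cantor n) :=
  (if e.1 then f2 else 1) * (if e.2 then f1 else 1).
have wb e i : commute (w e)^-1 (b ^+ i).
  apply/commuteX/commute_sym/commuteV/commuteM.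
    by case: ifP => _; [exact: commute_sym|exact: commute1].
  by case: ifP => _; [exact: commute_sym|exact: commute1].
have kw u : [~ f1, [~ f2, h]] u <> u -> exists e, agree m x ((w e)^-1 u).
  have ex e : h ((w e)^-1 u) <> (w e)^-1 u -> exists e, agree m x ((w e)^-1 u).
    by move=> /hin; exists e.
  move=> /commg_moved[] /commg_moved[] hu.
  - exact: (ex (false, false)).
  - exact: (ex (true, false)).
  - exact: (ex (false, true)).
  - exact: (ex (true, true)).
have /choice[E xE] : forall i : 'I_5, exists e, agree m x ((w e)^-1 ((b ^+ i) y0)).
  move=> i; apply: kw; have /commuteE -> : commute (b ^+ i) [~ f1, [~ f2, h]].
    exact/commute_sym/commuteX.
  by move=> /homeo_inj.
have [i [j [ij Eij]]] : exists i j : 'I_5, (i < j)%N /\ E i = E j.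
  apply: contrapT => nE; have /leq_card : injective E.
    move=> i j Eij; apply: val_inj; case: (ltngtP i j) => // ij; case: nE.
      by exists i, j.
    by exists j, i; split=> //; exact: esym.
  by rewrite card_ord card_prod card_bool.
have := bN (j - i)%N _ _ (xE i); apply; first by have := ltn_ord j; lia.
have := xE j; rewrite -Eij -[in b ^+ j](subnKC (ltnW ij)) expgD.
by have /commuteE -> := wb (E i) (j - i)%N.
Qed.

End Rubin.

(** * An isomorphism invariant *)

(** In terms of supports: if a torsion element [f] has dense support, then finitely many [h i] have
    supports disjoint from their images under [f], and the supports of the [h i ^+ 12] have dense
    union. *)
Definition torsion_displaceable (X : groupType) (A : set X) :=
  forall f N, A f -> f ^+ N.+1 = 1 ->
    (forall k, A k -> alg_disjoint A f k -> k ^+ 12 = 1) ->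
  exists (I : finType) (h : I -> X),
    (forall i, A (h i) /\ alg_disjoint A (h i) (h i ^ f)) /\
    forall k, A k -> (forall i, alg_disjoint A k (h i ^+ 12)) -> k = 1.

(** Every ingredient is expressed in the group operations of the subgroups. Since [phi] is
    multiplicative on [A] only, each transfer first needs membership in [A]. *)
Lemma isomorphic_displaceable (X Y : groupType) (A : set X) (B : set Y) :
  group_closed [in A] -> isomorphic A B ->
  torsion_displaceable B -> torsion_displaceable A.
Proof.
move=> Acl [phi [phiM' [phiB phiI phiS]]].
have A1 : A 1 by apply: set_mem; case: Acl.
have AM x y : A x -> A y -> A (x * y).
  by move=> Ax Ay; apply: set_mem; apply: (group_closedM Acl); exact: mem_set.
have AV x : A x -> A x^-1.
  by move=> Ax; apply: set_mem; apply: (group_closedV Acl); exact: mem_set.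
have AJ x y : A x -> A y -> A (x ^ y) by move=> Ax Ay; apply/AM/AM/Ay/Ax/AV.
have AR x y : A x -> A y -> A [~ x, y] by move=> Ax Ay; apply/AM/AJ => //; exact: AV.
have AX x k : A x -> A (x ^+ k).
  by move=> Ax; elim: k => // k IH; rewrite expgS; exact: AM.
have phiM x y : A x -> A y -> phi (x * y) = phi x * phi y.
  by move=> Ax Ay; apply: phiM'; exact: mem_set.
have phi1 : phi 1 = 1.
  by apply: (mulgI (phi 1)); rewrite mulg1 -phiM// mulg1.
have phiV x : A x -> phi x^-1 = (phi x)^-1.
  move=> Ax; apply: (mulgI (phi x)).
  by rewrite mulgV -phiM ?mulgV//; exact: AV.
have phiJ x y : A x -> A y -> phi (x ^ y) = phi x ^ phi y.
  by move=> Ax Ay; rewrite /conjg !phiM ?phiV//; try exact: AV; exact: AM.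
have phiR x y : A x -> A y -> phi [~ x, y] = [~ phi x, phi y].
  by move=> Ax Ay; rewrite /commg phiM ?phiV ?phiJ//; [exact: AV|exact: AJ].
have phiX x k : A x -> phi (x ^+ k) = phi x ^+ k.
  move=> Ax; elim: k => [|k IH]; first by rewrite !expg0.
  by rewrite !expgS phiM ?IH//; exact: AX.
have inj x y : A x -> A y -> phi x = phi y -> x = y.
  by move=> Ax Ay; apply: phiI; exact: mem_set.
have inj1 x : A x -> phi x = 1 -> x = 1.
  by move=> Ax; rewrite -phi1; exact: inj.
have surj y : B y -> exists2 x, A x & phi x = y by move=> /phiS[x Ax <-]; exists x.
have comm x y : A x -> A y -> commute x y -> commute (phi x) (phi y).
  by move=> Ax Ay xy; rewrite /commute -!phiM// xy.
have commI x y : A x -> A y -> commute (phi x) (phi y) -> commute x y.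
  by move=> Ax Ay; rewrite /commute -!phiM//; apply: inj; exact: AM.
have disj a b : A a -> A b ->
    alg_disjoint A a b <-> alg_disjoint B (phi a) (phi b).
  move=> Aa Ab; split=> ab.
    move=> _ /surj[h Ah <-] ah.
    have [|f1 [f2 [Af1 Af2 f1b f2b [kb k1]]]] := ab h Ah.
      by move=> /(comm _ _ Aa Ah).
    have Ak : A [~ f1, [~ f2, h]] by exact: (AR _ _ Af1 (AR _ _ Af2 Ah)).
    exists (phi f1), (phi f2).
    have -> : [~ phi f1, [~ phi f2, phi h]] = phi [~ f1, [~ f2, h]].
      by rewrite !phiR//; exact: AR.
    split; [exact: phiB|exact: phiB|exact: comm|exact: comm|split].
      exact: comm.
    by move=> /(inj1 _ Ak).
  move=> h Ah ah.
  have [||_ [_ [/surj[f1 Af1 <-] /surj[f2 Af2 <-] f1b f2b]]] := ab (phi h).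
  - exact: phiB.
  - by move=> /(commI _ _ Aa Ah).
  have Ak : A [~ f1, [~ f2, h]] by exact: (AR _ _ Af1 (AR _ _ Af2 Ah)).
  have -> : [~ phi f1, [~ phi f2, phi h]] = phi [~ f1, [~ f2, h]].
    by rewrite !phiR//; exact: AR.
  move=> [kb k1]; exists f1, f2.
  split=> //; [exact: commI|exact: commI|split; first exact: commI].
  by move=> k1'; apply: k1; rewrite k1' phi1.
move=> dB f N Af fN fdisj.
have [|||I [h [hdisp hcover]]] := dB (phi f) N.
- exact: phiB.
- by rewrite -phiX// fN.
- move=> _ /surj[k Ak <-] /(disj _ _ Af Ak) /(fdisj _ Ak) k12.
  by rewrite -phiX// k12.
have /choice[h' h'P] : forall i, exists x, A x /\ phi x = h i.
  by move=> i; have [/surj[x Ax xh] _] := hdisp i; exists x.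
have Ah' i : A (h' i) by have [] := h'P i.
have h'h i : phi (h' i) = h i by have [] := h'P i.
exists I, h'; split=> [i|k Ak kh].
  split=> //; apply/disj => //; first exact: AJ.
  by rewrite phiJ// h'h; have [] := hdisp i.
apply: inj1 => //; apply: hcover => [|i]; first exact: phiB.
by rewrite -h'h -phiX//; apply/disj => //; exact: AX.
Qed.

(** * Torsion elements and displacement of supports *)

Section Displacement.
Context {n : nat}.
Hypothesis n2 : (2 <= n)%N.
Implicit Types (x y z : Cantor n) (a b f h l : homeo (Cantor n))
  (g : 'S_n) (G : {group 'S_n}).

(** If [l] fixed a smaller cone pointwise, comparing tails there would force [q = m] and [g = 1],
    and [l] would be the identity on the whole cone of [x], including [y]. *)
Lemma moved_dense l x m q g y : acts_at l x m q g -> agree m x y -> l y <> y ->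
  forall z M, (m <= M)%N -> agree m x z -> exists2 u, agree M z u & l u <> u.
Proof.
move=> lx xy ly z M mM xz; apply: contrapT => nu.
have {}nu u : agree M z u -> l u = u.
  by move=> zu; apply: contrapT => lu; apply: nu; exists u.
have tail u k : agree M z u -> u (q + k)%N = g (u (m + k)%N).
  move=> zu; have [_ <-] := lx u (agree_trans xz (agree_le mM zu)).
  by rewrite nu.
have n0 : (0 < n)%N by lia.
pose c := Ordinal n0.
have [qm|qm] := eqVneq q m; last first.
  have [d dc] := other_letter (g c) n2; apply: dc.
  (* The letter [c] occurs in the tail at position [M + m] only, so for [q <> m] the tail relation
     at [k = M] would give [d = g c]. *)
  pose u := splice M z (fun t => if t == m then c else d).
  have := tail u M (@agree_splice _ _ _ _).
  by rewrite ![(_ + M)%N]addnC /u !splice_addn eqxx (negbTE qm).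
subst q; apply: ly.
have g1 i : g i = i.
  have := tail (splice M z (const i)) M (@agree_splice _ _ _ _).
  by rewrite ![(_ + M)%N]addnC !splice_addn.
have [lxz _] := lx z xz; have [lxy ly] := lx y xy.
apply/funext => k; have [km|mk] := ltnP k m.
  by rewrite -lxy// lxz// nu// -xz// xy.
by rewrite -(subnKC mk) ly g1.
Qed.

Lemma not_semiregular_displaceable G : ~ semiregular_perm G ->
  ~ torsion_displaceable (piecewise G).
Proof.
move=> /existsNP[g /not_implyP[gG /not_implyP[g1 /existsNP[i /negP]]]].
rewrite negbK => /eqP gi disp.
pose f := iterperm [::] g.
have fE x k : f x k = g (x k) by rewrite /= /iterperm_fun.
have fG : piecewise G f by exact: iterperm_piecewise.
have fX k x t : (f ^+ k) x t = (g ^+ k) (x t).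
  by elim: k x => [|k IH] x; rewrite ?perm1// homeo_expS IH fE expgS permM.
have [j gj] : exists j, g j <> j.
  apply: contrapT => /forallNP nj; move/eqP: g1; apply; apply/permP => j.
  by rewrite perm1; exact: contrapT.
have [||I [h [hdisp hcover]]] := disp f #[g].-1 fG.
- apply: homeoP => x; apply/funext => t.
  by rewrite fX prednK ?order_gt0// expg_order perm1.
- move=> k kG /(supports_of_alg_disjoint n2 fG kG) fk.
  apply: contrapT => /homeo_neq1[y ky].
  have [m km] := moved_cone (piecewiseX 12 kG) ky.
  pose z := splice m y (const j).
  have yz : agree m y z by exact: agree_splice.
  have [/(congr1 (fun u : Cantor n => u (m + 0)%N))|] := fk z; last exact: km.
  by rewrite fE /z splice_addn.
pose x0 := const i.
(* Each [h e ^+ 12] is trivial near the fixed point [x0]. Otherwise it moves all points of a small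
   cone around some [y] and, by density, some [u] near [f y]; then [u] is moved by it and by its
   conjugate under [f]. *)
have {}hdisp (e : I) : exists m, forall z, agree m x0 z -> (h e ^+ 12) z = z.
  have [hG hf] := hdisp e; pose l := h e ^+ 12.
  have lG : piecewise G l by exact: piecewiseX.
  have [m [q [ga gaG lx]]] := lG x0; exists m => y xy; apply: contrapT => ly.
  have [M lM] := moved_cone lG ly.
  have xfy : agree m x0 (f y) by move=> k km; rewrite fE -xy.
  have [u fyu lu] := moved_dense lx xy ly (leq_maxl m M) xfy.
  have yu : agree M y (f^-1 u).
    move=> k kM; apply: (@perm_inj _ g); rewrite -!fE homeo_KV; apply: fyu.
    by rewrite leq_max kM orbT.
  have [hu|] := supports_of_alg_disjoint n2 hG (piecewiseJ hG fG) hf u.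
    by apply: lu; exact: homeo_fixX.
  rewrite -conjXg homeo_conjE -/l => e'.
  by apply: (lM _ _ yu yu); apply: (@homeo_inj _ f); rewrite homeo_KV.
have /choice[N hN] := hdisp.
pose m := \max_e N e.
(* A non-trivial [k] supported where all the [h e ^+ 12] are trivial contradicts [hcover]. *)
have [k [k' [z [kG _ ko _ [_ kk]]]]] := noncommuting_exists G x0 m n2.
suff k1 : k = 1 by apply: kk; rewrite k1.
apply: hcover => // e; apply: alg_disjoint_of_supports => // x.
have [xx|xx] := pselect (agree m x0 x); last by left; exact: ko.
by right; apply: hN; apply: agree_le xx; exact: leq_bigmax.
Qed.

(* If [m < q], then [f] increases by [q - m] the length of the common prefix
   with [x] of a point that agrees with [x] on at least [m] letters. *)
Lemma torsion_not_attracting f N x m q : f ^+ N.+1 = 1 -> f x = x ->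
  acts_at f x m q 1 -> (q <= m)%N.
Proof.
move=> fN fx fmq; rewrite leqNgt; apply/negP => mq.
have [j jx] := other_letter (x m) n2.
pose z := splice m x (const j).
pose dist d u := agree d x u /\ u d <> x d.
have zm : dist m z by split; [exact: agree_splice|rewrite /z /splice ltnn].
have step e u : dist (m + e)%N u -> dist (q + e)%N (f u).
  move=> [xu ux]; have [fxu fu] := fmq u (agree_le (leq_addr e m) xu).
  have [_ fxx] := fmq x (@agree_refl _ m x); rewrite fx in fxu fxx.
  split=> [t te|]; last by rewrite fu fxx !perm1.
  have [tq|qt] := ltnP t q; first exact: fxu.
  by rewrite -(subnKC qt) fu fxx !perm1 xu//; lia.
have iter k : dist (m + k * (q - m))%N ((f ^+ k) z).
  elim: k => [|k IH]; first by rewrite addn0 expg0.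
  rewrite expgSr homeo_mulE; have := step _ _ IH; congr dist; lia.
have [+ _] := iter N.+1; rewrite fN => /(_ m) xz.
case: zm => _; apply; rewrite xz//; lia.
Qed.

Lemma torsion_isometric f N x m q : f ^+ N.+1 = 1 -> f x = x ->
  acts_at f x m q 1 -> q = m.
Proof.
move=> fN fx fmq; apply/eqP; rewrite eqn_leq (torsion_not_attracting fN fx fmq)/=.
have fVN : f^-1 ^+ N.+1 = 1 by rewrite expVgn fN invg1.
have := acts_at_inv fmq; rewrite fx invg1.
exact: torsion_not_attracting fVN (homeo_fixV fx).
Qed.

Lemma piecewise1_displaceable :
  torsion_displaceable (piecewise (1 : {group 'S_n})).
Proof.
set A := piecewise _; move=> f N fA fN fdisj.
have n0 : (0 < n)%N by lia.
pose c := Ordinal n0; have [d dc] := other_letter c n2.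
(* Near a fixed point [f] would be the identity; a shifter supported there is disjoint from [f], yet
   its twelfth power is not trivial. *)
have ffree x : f x <> x.
  move=> fx; have [m [q [_ /set1P -> fmq]]] := fA x.
  have qm := torsion_isometric fN fx fmq; subst q.
  have fid z : agree m x z -> f z = z.
    move=> xz; have [fxz fz] := fmq z xz; apply/funext => k.
    have [km|mk] := ltnP k m; first by rewrite -fxz// fx xz.
    by rewrite -(subnKC mk) fz perm1.
  have [s [sA so smoved]] := shifter_exists 1 x m c n2.
  pose z := splice m x (fun k => if k is 0 then c else d).
  have xz : agree m x z by exact: agree_splice.
  apply: (smoved 11 z 1%N xz); rewrite /z ?splice_addn//.
    by have := splice_addn m x (fun k => if k is 0 then c else d) 0; rewrite addn0.
  rewrite (fdisj s)//; apply: alg_disjoint_of_supports => // y.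
  by have [/fid|/so] := pselect (agree m x y); [left|right].
have [M fM] : exists M, forall y z, agree M y z -> ~ agree M y (f z).
  apply: (@uniform_prefix _ (fun y M => forall z, agree M y z -> ~ agree M y (f z))).
  - move=> y M yM z yz yfz.
    by apply: (yM z); [apply: agree_le yz|apply: agree_le yfz].
  - move=> y y' M yy' yM z y'z y'fz; apply: (yM z); exact: agree_trans yy' _.
  - move=> y; have [M fM] := moved_cone fA (ffree y); exists M => z yz yfz.
    exact: (fM _ _ yz yfz).
(* One shifter for each cone of a word of length [M], which [f] displaces, and each letter that may
   follow this word. *)
pose X (e : 'I_n * M.-tuple 'I_n) := wcat e.2 (const c).
have /choice[h hP] : forall e : 'I_n * M.-tuple 'I_n, exists s, [/\ A s,
    forall z, ~ agree M (X e) z -> s z = z &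
    forall k z t, agree M (X e) z -> z M = e.1 -> z (M + t)%N <> e.1 ->
      (s ^+ k.+1) z <> z].
  by move=> e; exact: shifter_exists.
exists ('I_n * M.-tuple 'I_n)%type, h; split=> [e|k kA kdisj].
  have [hA ho _] := hP e; split=> //; apply: alg_disjoint_of_supports => // y.
  have [Xy|/ho] := pselect (agree M (X e) y); last by left.
  right; rewrite homeo_conjE ho ?homeo_KV// => /fM.
  by rewrite homeo_KV; apply.
apply: contrapT => /homeo_neq1[x kx].
have [m km] := moved_cone kA kx.
have [j ji] := other_letter (x M) n2.
(* [y] is close enough to [x] to be moved by [k] and shares the letter at position [M]; a later
   letter [j] ensures that all positive powers of the shifter move it. *)
pose y := splice (m + M.+1) x (const j).
have xy : agree (m + M.+1) x y by exact: agree_splice.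
have yM : y M = x M by rewrite xy//; lia.
have sM : size (mkseq y M) == M by rewrite size_mkseq.
pose e := (x M, Tuple sM).
have [hA _ hmoved] := hP e.
have Xy : agree M (X e) y by rewrite -(eqP sM); apply/cone_agree/cone_mkseq.
have xym : agree m x y by apply: agree_le xy; exact: leq_addr.
(* The disjointness obtained concerns [(h e ^+ 12) ^+ 12], again a positive power of the shifter. *)
have [|] := supports_of_alg_disjoint n2 kA (piecewiseX 12 hA) (kdisj e) y.
  exact: km.
rewrite -expgM; apply: (hmoved _ _ m.+1) => //.
have -> : (M + m.+1 = m + M.+1 + 0)%N by lia.
by rewrite /y splice_addn.
Qed.

End Displacement.

Theorem theorem1 (n : nat) (hn : (2 <= n)%N) (G : {group 'S_n}) :
  isomorphic (HigmanThompson_ext G) (HigmanThompson n) <-> semiregular_perm G.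
Proof.
have n0 : (0 < n)%N by exact: ltnW.
rewrite HigmanThompson_extE// HigmanThompsonE//; split=> [iso|].
  apply: contrapT => /(not_semiregular_displaceable hn); apply.
  apply: isomorphic_displaceable iso (piecewise1_displaceable hn).
  exact: piecewise_closed.
by move=> /semiregular_cocycle[lam [lamG lamM]]; exact: recoding_isomorphic lamM.
Qed.
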